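(* Let $q\in\{2,3,5,7,11\}$ and let $G$ be a subgroup of $\mathrm{SL}_2(q)$ acting sharply transitively on the non-zero vectors of $\mathbb{F}_q^2$, where $G\cong\mathrm{GL}_1(4)$ if $q=2$, $G\cong Q_8$ if $q=3$, $G\cong 2.\mathrm{A}_4$ if $q=5$, $G\cong 2.\mathrm{S}_4$ if $q=7$, and $G\cong \mathrm{SL}_2(5)$ if $q=11$. Let $V=\mathbb{F}_q^4$ be equipped with the symplectic form $f(x,y)=x_1y_2-x_2y_1-x_3y_4+x_4y_3$, which defines $\mathsf{W}_3(q)$, and let $$C=\{\,\text{row space of } [\,I\mid A\,] : A\in G\,\},$$ where $I$ is the $2\times 2$ identity matrix and $[\,I\mid A\,]$ is the $2\times 4$ matrix with blocks $I$ and $A$. Then $C$ is a neighbour-transitive maximal partial spread of $\mathsf{W}_3(q)$.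
   Context: $\mathsf{W}_3(q)$: the points are the $1$-dimensional subspaces of $V$, the lines are the totally isotropic $2$-dimensional subspaces of $V$ with respect to $f$, incidence is symmetrised containment. Its point-line incidence graph $\varGamma$ has all points and lines as vertices, with adjacency given by incidence. A partial spread is a set of lines such that each point is incident with at most one line of the set; it is maximal if it is not properly contained in another partial spread. A code $C$ is a subset of the vertex set of $\varGamma$; $C_1$ is the set of vertices not in $C$ that are adjacent to some element of $C$; $\operatorname{Aut}(C)$ is the setwise stabiliser of $C$ in $\operatorname{Aut}(\varGamma)$; $C$ is neighbour-transitive if $\operatorname{Aut}(C)$ acts transitively on each of $C$ and $C_1$. Here $2.\mathrm{A}_4$ and $2.\mathrm{S}_4$ denote the double covers of $\mathrm{A}_4$ and $\mathrm{S}_4$ (of orders $24$ and $48$) occurring as subgroups of $\mathrm{SL}_2(5)$ and $\mathrm{SL}_2(7)$ respectively; in every case $|G|=q^2-1$. *)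

(* Defs.v *)
From HB Require Import structures.
From mathcomp Require Import all_boot all_order all_fingroup all_algebra.
From mathcomp Require Import all_solvable all_field.

Set Implicit Arguments.
Unset Strict Implicit.
Unset Printing Implicit Defensive.

Import GroupScope GRing.Theory.
Local Open Scope ring_scope.

(* vector.v encodes a subspace by a canonical matrix, whence the finiteness. *)
HB.instance Definition _ (F : finFieldType) (vT : vectType F) :=
  CanIsCountable (@VectorInternalTheory.vs2mxK F vT).
HB.instance Definition _ (F : finFieldType) (vT : vectType F) :
    isFinite {vspace vT} :=
  CanIsFinite (@VectorInternalTheory.vs2mxK F vT).

Section Graph.

Variables (T : finType) (e : rel T).

Definition graph_aut : {set {perm T}} :=
  [set s : {perm T} | [forall x, forall y, e (s x) (s y) == e x y]].

Lemma graph_aut_group_set : group_set graph_aut.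
Proof.
apply/group_setP; split=> [|s t].
  by rewrite inE; apply/forallP=> x; apply/forallP=> y; rewrite !perm1.
rewrite !inE => /forallP es /forallP et.
apply/forallP=> x; apply/forallP=> y; rewrite !permM.
by rewrite (eqP (forallP (et _) _)) (eqP (forallP (es _) _)).
Qed.
Canonical graph_aut_group := Group graph_aut_group_set.

Definition code_aut (C : {set T}) : {set {perm T}} := 'N_graph_aut(C | 'P).

Definition code_neighbours (C : {set T}) : {set T} :=
  [set x | (x \notin C) && [exists y in C, e x y]].

(* [transitive _, on S | _] also asserts that S is non-empty. *)
Definition neighbour_transitive (C : {set T}) : bool :=
  [transitive code_aut C, on C | 'P]
  && [transitive code_aut C, on code_neighbours C | 'P].

End Graph.

Definition SLgroup (n : nat) (F : finFieldType) : {set {'GL_n[F]}} :=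
  [set A : {'GL_n[F]} | \det (GLval A) == 1].

Lemma SLgroup_group_set n F : group_set (SLgroup n F).
Proof.
apply/group_setP; split=> [|A B]; rewrite !inE; first by rewrite GL_1E det1.
by move=> /eqP dA /eqP dB; rewrite GL_ME det_mulmx dA dB mulr1.
Qed.
Canonical SLgroup_group n F := Group (@SLgroup_group_set n F).

Notation "''SL_' n ( p )" := (SLgroup n 'F_p)
  (at level 0, n at level 2, format "''SL_' n ( p )") : group_scope.

(* The field with four elements; 'F_4 would be the prime field of order 2. *)
Definition GF4 : finFieldType :=
  s2val (@pPrimePowerField 2 2 isT isT).

(* A double cover is a stem extension by a group of order 2: the kernel is
   central and contained in the derived subgroup. *)
Definition double_cover (gT rT : finGroupType)
    (G : {group gT}) (K : {group rT}) : Prop :=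
  exists Z : {group gT},
    [/\ Z \subset 'Z(G) :&: G^`(1)%g, #|Z| = 2%N & (G / Z)%g \isog K].

(* S_4 has two non-isomorphic double covers; occurring as a subgroup of SL_2(p)
   selects the one with a unique involution. *)
Definition double_cover_in_SL2 (p : nat) (gT rT : finGroupType)
    (G : {group gT}) (K : {group rT}) : Prop :=
  double_cover G K
  /\ exists H : {group {'GL_2['F_p]}}, H \subset 'SL_2(p)%g /\ G \isog H.

Definition sharply_transitive_nonzero (F : finFieldType)
    (G : {set {'GL_2[F]}}) : Prop :=
  forall v w : 'rV[F]_2, v != 0 -> w != 0 ->
    exists! A : {'GL_2[F]}, A \in G /\ v *m GLval A = w.

Section SymplecticSpace.

Variable q : nat.
Implicit Types U : {vspace 'rV['F_q]_4}.

Definition sform (x y : 'rV['F_q]_4) : 'F_q :=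
  x 0 0 * y 0 1 - x 0 1 * y 0 0 - x 0 2 * y 0 3 + x 0 3 * y 0 2.

Definition totally_isotropic U : bool :=
  [forall x in U, forall y in U, sform x y == 0].

Definition is_point U : bool := \dim U == 1%N.

Definition is_line U : bool := (\dim U == 2%N) && totally_isotropic U.

Definition W3_vertex : Type :=
  {U : {vspace 'rV['F_q]_4} | is_point U || is_line U}.

Definition W3_adj : rel W3_vertex := fun u v =>
  [|| [&& is_point (val u), is_line (val v) & (val u <= val v)%VS]
    | [&& is_point (val v), is_line (val u) & (val v <= val u)%VS]].

Definition partial_spread (S : {set {vspace 'rV['F_q]_4}}) : bool :=
  [forall U in S, is_line U]
  && [forall (P | is_point P), (#|[set U in S | (P <= U)%VS]| <= 1)%N].

Definition maximal_partial_spread (S : {set {vspace 'rV['F_q]_4}}) : bool :=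
  maxset partial_spread S.

(* The vertices of the incidence graph lying in S; members of S that are neither
   points nor lines are lost, but partial_spread requires all to be lines. *)
Definition W3_code (S : {set {vspace 'rV['F_q]_4}}) : {set W3_vertex} :=
  [set u | val u \in S].

Definition row_space (m : nat) (M : 'M['F_q]_(m, 4)) : {vspace 'rV['F_q]_4} :=
  <<[seq row i M | i : 'I_m]>>%VS.

Definition row_space_code (G : {set {'GL_2['F_q]}}) :
    {set {vspace 'rV['F_q]_4}} :=
  [set row_space (row_mx 1%:M (GLval A) : 'M['F_q]_(2, 2 + 2))
     | A : {'GL_2['F_q]} in G].

End SymplecticSpace.

(* Main.v *)
(** The lines of the code partition the points [<(v, w)>] with [v] and [w] both
    non-zero: sharp transitivity of [G] gives exactly one [A] in [G] with
    [v A = w], and then [(v, w)] lies on [[I | A]] only.  The uncovered points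
    lie on [[I | 0]] and [[0 | I]]; a line all of whose points are uncovered is
    one of these two, and neither is totally isotropic.  Since [G] lies in
    [SL_2], the matrices [diag(X, B)] with [X] and [B] in [G] preserve the form
    and map [[I | A]] to [[I | X^-1 A B]]; they are transitive on the pairs
    [(v, w)] of non-zero vectors, hence on the neighbours of the code. *)

Require Import Defs.
From mathcomp Require Import all_boot all_order all_fingroup all_algebra.
From mathcomp Require Import all_solvable all_field.
From mathcomp Require Import ring.

Set Implicit Arguments.
Unset Strict Implicit.
Unset Printing Implicit Defensive.

Import GRing.Theory.

(** * Neighbour-transitivity from explicit automorphisms *)

Section NeighbourTransitivity.

Variables (T : finType) (e : rel T) (C : {set T}).

Lemma code_autP (s : {perm T}) :
  reflect ((forall x y, e (s x) (s y) = e x y) /\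
           (forall x, (s x \in C) = (x \in C)))
          (s \in code_aut e C).
Proof.
apply: (iffP idP) => [/setIP[] | [se sC]].
  rewrite inE => /forallP se /astabsP sC.
  by split=> x; [move=> y; apply/eqP/(forallP (se x)) | apply: sC].
rewrite inE; apply/andP; split.
  by rewrite inE; apply/forallP=> x; apply/forallP=> y; rewrite se.
by apply/astabsP=> x; apply: sC.
Qed.

Lemma code_neighbours_aut (s : {perm T}) x :
  s \in code_aut e C ->
  (s x \in code_neighbours e C) = (x \in code_neighbours e C).
Proof.
case/code_autP=> se sC; rewrite !inE sC; congr (_ && _).
apply/exists_inP/exists_inP => -[y yC exy].
  by exists (s^-1%g y); [rewrite -sC permKV | rewrite -se permKV].
by exists (s y); rewrite ?sC ?se.
Qed.

Lemma perm_transitive (A : {group {perm T}}) (S : {set T}) x0 :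
  x0 \in S ->
  (forall s x, s \in A -> x \in S -> s x \in S) ->
  (forall x, x \in S -> exists2 s, s \in A & s x0 = x) ->
  [transitive A, on S | 'P].
Proof.
move=> x0S AS trS; apply/imsetP; exists x0 => //.
apply/setP=> x; apply/idP/orbitP => [/trS[s sA <-] | [s sA <-]].
  by exists s.
exact: AS.
Qed.

(** Automorphisms stabilising [C] also stabilise its neighbour set, so it is enough to reach every
    vertex of each set from one base vertex. *)
Lemma neighbour_transitiveP x0 y0 :
  x0 \in C -> y0 \in code_neighbours e C ->
  (forall x, x \in C -> exists2 s, s \in code_aut e C & s x0 = x) ->
  (forall y, y \in code_neighbours e C ->
     exists2 s, s \in code_aut e C & s y0 = y) ->
  neighbour_transitive e C.
Proof.
move=> x0C y0N trC trN; apply/andP; split.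
  apply: (perm_transitive x0C) trC => s x /code_autP[_ sC].
  by rewrite sC.
apply: (perm_transitive y0N) trN => s y sA.
by rewrite code_neighbours_aut.
Qed.

End NeighbourTransitivity.

(** * The determinant form on a plane *)

Section Area.

Local Open Scope ring_scope.

Variable R : comNzRingType.
Implicit Types (a b : 'rV[R]_2) (A : 'M[R]_2).

Definition area a b : R := a 0 0 * b 0 1 - a 0 1 * b 0 0.

Lemma big_ord2 (F : 'I_2 -> R) : \sum_i F i = F 0 + F 1.
Proof.
by rewrite big_ord_recl big_ord1; congr (F _ + F _); apply: val_inj.
Qed.

Lemma det_mx22 A : \det A = A 0 0 * A 1 1 - A 0 1 * A 1 0.
Proof.
rewrite (expand_det_row _ 0) big_ord2 /cofactor !det_mx11 !mxE /=.
have -> : lift 0 0 = 1 :> 'I_2 by apply: val_inj.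
have -> : lift 1 0 = 0 :> 'I_2 by apply: val_inj.
by rewrite expr0 expr1 mul1r mulN1r mulrN.
Qed.

Lemma area_mulmx a b A : area (a *m A) (b *m A) = \det A * area a b.
Proof. by rewrite /area det_mx22 !mxE !big_ord2; ring. Qed.

End Area.

(** * The symplectic space as a sum of two planes, and graphs of matrices as lines *)

Section SymplecticForm.

Local Open Scope ring_scope.

Variable q : nat.
Implicit Types (a b c d : 'rV['F_q]_2) (A B : 'M['F_q]_2).
Implicit Types (u : 'rV['F_q]_4) (U : {vspace 'rV['F_q]_4}).

(** The inner type ['rV_(2 + 2)] is convertible to ['rV_4]; the lemmas that follow restate the block
    identities at size 4. *)
Definition pair_row a b : 'rV['F_q]_4 := row_mx a b : 'rV_(2 + 2).

Lemma pair_row_surj u : exists a b, u = pair_row a b.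
Proof.
exists (@lsubmx _ _ 2 2 u), (@rsubmx _ _ 2 2 u).
by rewrite /pair_row hsubmxK.
Qed.

Lemma eq_pair_row a b c d : pair_row a b = pair_row c d -> a = c /\ b = d.
Proof. exact: (@eq_row_mx _ 1 2 2 a b c d). Qed.

Lemma pair_row_eq0 a b : (pair_row a b == 0) = (a == 0) && (b == 0).
Proof. exact: (@row_mx_eq0 _ 1 2 2 a b). Qed.

Lemma add_pair_row a b c d :
  pair_row a b + pair_row c d = pair_row (a + c) (b + d).
Proof. exact: (@add_row_mx _ 1 2 2 a b c d). Qed.

(** The minus sign between the two areas is what makes the graph of a matrix of determinant 1
    totally isotropic. *)
Lemma sform_pair_row a b c d :
  sform (pair_row a b) (pair_row c d) = area a c - area b d.
Proof.
have eL (x y : 'rV['F_q]_2) (i : 'I_4) (j : 'I_2) :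
    i = j :> nat -> pair_row x y 0 i = x 0 j.
  by move=> eij; rewrite -(row_mxEl x y); congr (row_mx x y _ _); apply: val_inj.
have eR (x y : 'rV['F_q]_2) (i : 'I_4) (j : 'I_2) :
    i = (2 + j)%N :> nat -> pair_row x y 0 i = y 0 j.
  by move=> eij; rewrite -(row_mxEr x y); congr (row_mx x y _ _); apply: val_inj.
rewrite /sform /area !(eL _ _ 0 0) // !(eL _ _ 1 1) // !(eR _ _ 2 0) //.
by rewrite !(eR _ _ 3 1) //; ring.
Qed.

Lemma totally_isotropicP U :
  reflect {in U &, forall x y, sform x y = 0} (totally_isotropic U).
Proof.
apply: (iffP forall_inP) => [tiU x y xU yU | tiU x xU].
  by apply/eqP/(forall_inP (tiU x xU)).
by apply/forall_inP=> y yU; apply/eqP/tiU.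
Qed.

Definition graph_line A : {vspace 'rV['F_q]_4} :=
  row_space (row_mx 1%:M A : 'M_(2, 2 + 2)).

Lemma mulmx_row1mx a A :
  a *m (row_mx 1%:M A : 'M_(2, 2 + 2)) = pair_row a (a *m A).
Proof. by rewrite mul_mx_row mulmx1. Qed.

(** As the image of a linear map, a row space gets its membership test and its dimension from the
    facts about [limg]. *)
Lemma row_space_limg m (M : 'M['F_q]_(m, 4)) :
  row_space M = limg (linfun (mulmxr M : 'rV_m -> 'rV_4)).
Proof.
apply/vspaceP=> u; apply/idP/memv_imgP => [|[v _ ->]].
  suff /subvP: (row_space M <= limg (linfun (mulmxr M : 'rV_m -> 'rV_4)))%VS.
    by move=> sub /sub/memv_imgP.
  apply/span_subvP=> _ /imageP[i _ ->].
  have -> : row i M = linfun (mulmxr M) (delta_mx 0 i : 'rV_m).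
    by rewrite lfunE /= rowE.
  exact/memv_img/memvf.
rewrite lfunE /= mulmx_sum_row; apply: rpred_sum => i _.
by apply/rpredZ/memv_span/image_f.
Qed.

Lemma mem_graph_line a b A : (pair_row a b \in graph_line A) = (b == a *m A).
Proof.
rewrite /graph_line row_space_limg.
apply/memv_imgP/eqP => [[c _] | ->].
  by rewrite lfunE /= mulmx_row1mx => /eq_pair_row[-> ->].
by exists a; rewrite ?memvf // lfunE /= mulmx_row1mx.
Qed.

Lemma dim_graph_line A : \dim (graph_line A) = 2.
Proof.
rewrite /graph_line row_space_limg limg_dim_eq ?dimvf ?dim_matrix //.
apply/eqP; rewrite -subv0; apply/subvP=> a.
rewrite memv_cap memv_ker lfunE /= mulmx_row1mx => /andP[_].
by rewrite pair_row_eq0 memv0 => /andP[].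
Qed.

Lemma graph_line_isotropic A : \det A = 1 -> is_line (graph_line A).
Proof.
move=> dA; rewrite /is_line dim_graph_line eqxx.
apply/totally_isotropicP=> u v.
have [a [b ->]] := pair_row_surj u; have [c [d ->]] := pair_row_surj v.
rewrite !mem_graph_line => /eqP-> /eqP->.
by rewrite sform_pair_row area_mulmx dA mul1r subrr.
Qed.

(* Otherwise all points of [U] lie on [[I | 0]] and [[0 | I]]; mixing both kinds
   is excluded by adding vectors, so [U] is one of these two hyperbolic lines. *)
Lemma is_line_pair_row U :
  is_line U ->
  exists a b, [/\ a != 0, b != 0 & pair_row a b \in U].
Proof.
case/andP=> dU /totally_isotropicP tiU.
have [/existsP[a /existsP[b /and3P[a0 b0 abU]]] | noU] :=
  boolP [exists a, exists b, [&& a != 0, b != 0 & pair_row a b \in U]].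
  by exists a, b.
have cov a b : pair_row a b \in U -> (a == 0) || (b == 0).
  move=> abU; apply: contraNT noU; rewrite negb_or => /andP[a0 b0].
  by apply/existsP; exists a; apply/existsP; exists b; rewrite a0 b0.
(* If [U] lies in the row space of [M], then by dimension it is that row space, and the form
   vanishes on it. Were this to force all areas to vanish, the area of the standard basis, which is
   1, would be 0. *)
have area_e (M : 'M_(2, 4)) :
    {in U, forall u, exists a, u = a *m M} ->
    (forall a b, sform (a *m M) (b *m M) = 0 -> area a b = 0) -> False.
  move=> UM MA; pose F := linfun (mulmxr M : 'rV_2 -> 'rV_4).
  have sU : (U <= limg F)%VS.
    apply/subvP=> u /UM[a ->]; apply/memv_imgP.
    by exists a; rewrite ?memvf ?lfunE.
  have eU : U = limg F.
    apply/eqP; rewrite eqEdim sU (eqP dU).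
    (* Rank-nullity bounds the dimension of the image by 2. *)
    rewrite (leq_trans (leq_addl (\dim (fullv :&: lker F)) _)) //.
    by rewrite limg_ker_dim dimvf dim_matrix.
  have MU a : a *m M \in U.
    by rewrite eU; apply/memv_imgP; exists a; rewrite ?memvf ?lfunE.
  have := MA (delta_mx 0 0) (delta_mx 0 1) (tiU _ _ (MU _) (MU _)).
  by rewrite /area !mxE /= mulr1 mulr0 subr0; apply/eqP/oner_neq0.
have hL c : c *m (row_mx 1%:M 0 : 'M_(2, 2 + 2)) = pair_row c 0.
  by rewrite mul_mx_row mulmx1 mulmx0.
have hR c : c *m (row_mx 0 1%:M : 'M_(2, 2 + 2)) = pair_row 0 c.
  by rewrite mul_mx_row mulmx1 mulmx0.
have mixed a b : pair_row a 0 \in U -> pair_row 0 b \in U ->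
    (a == 0) || (b == 0).
  by move=> aU bU; have := rpredD aU bU; rewrite add_pair_row addr0 add0r => /cov.
(* A non-zero [(a, 0)] in [U] forces, by [mixed], every second component to vanish, so [U] lies in
   [[I | 0]]; without such a vector [U] lies in [[0 | I]]. *)
exfalso; have [/existsP[a /andP[a0 aU]] | noa] :=
  boolP [exists a, (a != 0) && (pair_row a 0 \in U)].
  apply: (area_e (row_mx 1%:M 0 : 'M_(2, 2 + 2))).
  - move=> u uU; have [c [d eu]] := pair_row_surj u.
    move: uU; rewrite {u}eu => cdU; exists c; rewrite hL; congr pair_row.
    case/orP: (cov _ _ cdU) => /eqP e0 //; rewrite e0 in cdU *.
    by case/orP: (mixed _ _ aU cdU) => /eqP // a0'; rewrite a0' eqxx in a0.
  - by move=> c d; rewrite !hL sform_pair_row {2}/area !mxE !mul0r !subr0.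
apply: (area_e (row_mx 0 1%:M : 'M_(2, 2 + 2))).
- move=> u uU; have [c [d eu]] := pair_row_surj u.
  move: uU; rewrite {u}eu => cdU; exists d; rewrite hR; congr pair_row.
  case/orP: (cov _ _ cdU) => /eqP e0 //; rewrite e0 in cdU *.
  apply: contraNeq noa => c0; apply/existsP; exists c.
  by rewrite c0.
- move=> c d; rewrite !hR sform_pair_row {1}/area !mxE !mul0r subrr sub0r.
  by move/eqP; rewrite oppr_eq0 => /eqP.
Qed.

Lemma is_point_pick U P :
  is_point P -> (P <= U)%VS -> exists2 u, u != 0 /\ u \in U & P = <[u]>%VS.
Proof.
move=> /eqP dP sPU; have nzP : vpick P != 0 by rewrite vpick0 -dimv_eq0 dP.
exists (vpick P); first by split=> //; apply/(subvP sPU)/memv_pick.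
by apply/esym/eqP; rewrite eqEdim -memvE memv_pick dim_vline nzP dP.
Qed.

Lemma is_point_line u : u != 0 -> is_point <[u]>%VS.
Proof. by rewrite /is_point dim_vline => ->. Qed.

Definition W3_vertex_of U (hU : is_point U || is_line U) : W3_vertex q :=
  exist _ U hU.

(** * Graph automorphisms induced by isometries *)

Section Isometry.

Variable f : 'End('rV['F_q]_4).
Hypothesis f_inj : lker f == 0%VS.
Hypothesis f_iso : forall x y, sform (f x) (f y) = sform x y.

Lemma dim_img_isometry U : \dim (f @: U) = \dim U.
Proof. by rewrite limg_dim_eq // (eqP f_inj) capv0. Qed.

Lemma is_point_isometry U : is_point (f @: U)%VS = is_point U.
Proof. by rewrite /is_point dim_img_isometry. Qed.

Lemma is_line_isometry U : is_line (f @: U)%VS = is_line U.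
Proof.
rewrite /is_line dim_img_isometry; congr (_ && _).
apply/totally_isotropicP/totally_isotropicP => tiU.
  by move=> x y xU yU; rewrite -f_iso tiU ?memv_img.
by move=> _ _ /memv_imgP[x xU ->] /memv_imgP[y yU ->]; rewrite f_iso tiU.
Qed.

Lemma W3_isometry_perm :
  exists s : {perm W3_vertex q}, forall x, val (s x) = (f @: val x)%VS.
Proof.
have valid (x : W3_vertex q) :
    is_point (f @: val x)%VS || is_line (f @: val x)%VS.
  by rewrite is_point_isometry is_line_isometry; apply: valP x.
pose F (x : W3_vertex q) : W3_vertex q := W3_vertex_of (valid x).
have F_inj : injective F.
  move=> x y /(congr1 val)/= /eqP.
  by rewrite eq_limg_ker0 // => /eqP/val_inj.
by exists (perm F_inj) => x; rewrite permE.
Qed.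

(** Mapping [S] into itself is enough: the induced map is a permutation of a finite set, so it then
    stabilises the code. Adjacency is kept because an injective map preserves and reflects
    inclusion. *)
Lemma code_aut_isometry (S : {set {vspace 'rV['F_q]_4}}) :
  (forall U, U \in S -> (f @: U)%VS \in S) ->
  exists2 s, s \in code_aut (@W3_adj q) (W3_code S)
           & forall x, val (s x) = (f @: val x)%VS.
Proof.
move=> fS; have [s sE] := W3_isometry_perm; exists s => //.
apply/setIP; split.
  rewrite inE; apply/forallP=> x; apply/forallP=> y; apply/eqP.
  by rewrite /W3_adj !sE !is_point_isometry !is_line_isometry !limg_ker0.
rewrite !inE /=; apply/subsetP=> x; rewrite !inE => /fS.
by rewrite -sE.
Qed.

End Isometry.

(** The form is a difference of two areas, and each diagonal block, having determinant 1, preserves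
    its own. *)
Lemma diag_isometry A B :
  \det A = 1 -> \det B = 1 ->
  exists f : 'End('rV['F_q]_4),
    [/\ lker f == 0%VS, forall x y, sform (f x) (f y) = sform x y
      & forall a b, f (pair_row a b) = pair_row (a *m A) (b *m B)].
Proof.
move=> dA dB; pose f : 'End('rV['F_q]_4) :=
  linfun (mulmxr (block_mx A 0 0 B : 'M_(2 + 2)) : 'rV_(2 + 2) -> 'rV_(2 + 2)).
have fE a b : f (pair_row a b) = pair_row (a *m A) (b *m B).
  rewrite lfunE /= [LHS](@mul_row_block _ 1 2 2 2 2 a b).
  by rewrite !mulmx0 addr0 add0r.
exists f; split=> //.
  rewrite -subv0; apply/subvP=> u.
  have [a [b ->]] := pair_row_surj u.
  rewrite memv_ker memv0 fE !pair_row_eq0.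
  have inj0 (M : 'M_2) c : \det M = 1 -> c *m M == 0 -> c == 0.
    move=> dM /eqP cM; have uM : M \in unitmx by rewrite unitmxE dM unitr1.
    by rewrite -(mulmxK uM c) cM mul0mx.
  by case/andP=> /(inj0 _ _ dA)-> /(inj0 _ _ dB)->.
move=> x y; have [a [b ->]] := pair_row_surj x.
have [c [d ->]] := pair_row_surj y.
by rewrite !fE !sform_pair_row !area_mulmx dA dB !mul1r.
Qed.

(** * The code of a sharply transitive group *)

Section Code.

Variable G : {group {'GL_2['F_q]}}.
Hypothesis sGSL : G \subset SLgroup 2 'F_q.
Hypothesis trG : sharply_transitive_nonzero G.

Local Notation code := (row_space_code G).
Implicit Types X Y Z : {'GL_2['F_q]}.

Lemma det_G X : X \in G -> \det (GLval X) = 1.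
Proof. by move/(subsetP sGSL); rewrite inE => /eqP. Qed.

Lemma row_space_codeP U :
  reflect (exists2 X, X \in G & U = graph_line (GLval X)) (U \in code).
Proof. exact: imsetP. Qed.

Lemma graph_line_code X : X \in G -> graph_line (GLval X) \in code.
Proof. exact: imset_f. Qed.

Lemma sharp_exists a b :
  a != 0 -> b != 0 -> exists2 X, X \in G & a *m GLval X = b.
Proof. by move=> a0 b0; have [X [[XG aX] _]] := trG a0 b0; exists X. Qed.

Lemma sharp_uniq a X Y :
  a != 0 -> X \in G -> Y \in G -> a *m GLval X = a *m GLval Y -> X = Y.
Proof.
(* Sharp transitivity speaks only of non-zero images; invertibility of [X] provides one. *)
move=> a0 XG YG aXY; have aX0 : a *m GLval X != 0.
  apply: contraNneq a0 => aX.
  by rewrite -(mulmxK (GL_unitmx X) a) [a *m _]aX mul0mx.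
have [Z [_ Zu]] := trG a0 aX0.
by rewrite -(Zu X) // -(Zu Y).
Qed.

Lemma code_point_neq0 a b X :
  pair_row a b \in graph_line (GLval X) -> pair_row a b != 0 ->
  a != 0 /\ b != 0.
Proof.
rewrite mem_graph_line => /eqP-> nz.
have a0 : a != 0.
  by apply: contraNneq nz => ->; rewrite mul0mx pair_row_eq0 eqxx.
split=> //; apply: contraNneq a0 => aX.
by rewrite -(mulmxK (GL_unitmx X) a) [a *m _]aX mul0mx.
Qed.

Lemma row_space_code_partial_spread : partial_spread code.
Proof.
apply/andP; split.
  apply/forall_inP=> _ /row_space_codeP[X XG ->].
  by rewrite graph_line_isotropic ?det_G.
apply/forall_inP=> P ptP; apply/card_le1_eqP=> U W; rewrite !inE.
case/andP=> /row_space_codeP[X XG ->] sPX /andP[/row_space_codeP[Y YG ->] sPY].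
have [u [u0 uX] eP] := is_point_pick ptP sPX.
move: sPY; rewrite eP -memvE; move: u0 uX.
have [a [b ->]] := pair_row_surj u => u0 abX.
have [a0 _] := code_point_neq0 abX u0; move: abX.
rewrite !mem_graph_line => /eqP-> /eqP aXY.
by rewrite (sharp_uniq a0 XG YG aXY).
Qed.

Lemma row_space_code_maximal : maximal_partial_spread code.
Proof.
apply/maxsetP; split=> [|S /andP[/forall_inP linS /forall_inP disS] sCS].
  exact: row_space_code_partial_spread.
apply/eqP; rewrite eqEsubset sCS andbT; apply/subsetP=> U US.
have [a [b [a0 b0 abU]]] := is_line_pair_row (linS U US).
have [X XG aX] := sharp_exists a0 b0.
have nz : pair_row a b != 0 by rewrite pair_row_eq0 negb_and a0.
(* Both [U] and the code line of [X] belong to [S] and pass through [<(a, b)>], so they coincide. *)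
have /card_le1_eqP/(_ (graph_line (GLval X)) U) := disS _ (is_point_line nz).
rewrite !inE -!memvE US abU mem_graph_line aX eqxx andbT.
rewrite (subsetP sCS) ?graph_line_code // => ->//.
exact: graph_line_code.
Qed.

(** The vector [(a, aZ)] goes to [(aX, aZY)], which is [(c, c X^-1 Z Y)] for [c = aX]. *)
Lemma code_aut_diag X Y :
  X \in G -> Y \in G ->
  exists f : 'End('rV['F_q]_4), exists2 s,
    s \in code_aut (@W3_adj q) (W3_code code)
  & [/\ forall x, val (s x) = (f @: val x)%VS,
       forall a b, f (pair_row a b) = pair_row (a *m GLval X) (b *m GLval Y)
     & forall Z, (f @: graph_line (GLval Z))%VS =
                 graph_line (GLval (X^-1 * Z * Y)%g)].
Proof.
move=> XG YG; have [f [f_inj f_iso fE]] := diag_isometry (det_G XG) (det_G YG).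
have fL Z :
    (f @: graph_line (GLval Z))%VS = graph_line (GLval (X^-1 * Z * Y)%g).
  apply/eqP; rewrite eqEdim dim_img_isometry // !dim_graph_line leqnn andbT.
  apply/subvP=> _ /memv_imgP[u + ->]; have [a [b ->]] := pair_row_surj u.
  rewrite fE !mem_graph_line => /eqP->.
  rewrite !GL_ME GL_VE -!mulmxE !mulmxA.
  rewrite -[(GLval X)^-1]/(invmx (GLval X)) mulmxK //; exact: (GL_unitmx X).
have fS U : U \in code -> (f @: U)%VS \in code.
  case/row_space_codeP=> Z ZG ->; rewrite fL graph_line_code //.
  by rewrite !groupM ?groupV.
have [s sA sE] := code_aut_isometry f_inj f_iso fS.
by exists f, s.
Qed.

Lemma code_neighboursP (x : W3_vertex q) :
  reflect (exists a b, [/\ a != 0, b != 0 & val x = <[pair_row a b]>%VS])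
          (x \in code_neighbours (@W3_adj q) (W3_code code)).
Proof.
rewrite inE; apply: (iffP andP) => [[_ /exists_inP[y]] | [a [b [a0 b0 xE]]]].
  rewrite inE => /row_space_codeP[X XG yE].
  (* A code line has dimension 2 and is no point, so the vertex adjacent to it must be the point of
     the pair. *)
  rewrite /W3_adj yE [is_point (graph_line _)]/is_point dim_graph_line /= orbF.
  case/and3P=> ptx _ /(is_point_pick ptx)[u [u0 +] ->].
  move: u0; have [a [b ->]] := pair_row_surj u => nz /code_point_neq0[] // a0 b0.
  by exists a, b.
have nz : pair_row a b != 0 by rewrite pair_row_eq0 negb_and a0.
have [X XG aX] := sharp_exists a0 b0; split.
  rewrite inE xE; apply/negP=> /row_space_codeP[Z _ /(congr1 (fun U => \dim U))].
  by rewrite dim_graph_line dim_vline nz.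
have lineX := graph_line_isotropic (det_G XG).
have vX : is_point (graph_line (GLval X)) || is_line (graph_line (GLval X)).
  by rewrite lineX orbT.
apply/exists_inP; exists (W3_vertex_of vX).
  by rewrite inE graph_line_code.
by rewrite /W3_adj xE /= is_point_line // lineX -memvE mem_graph_line aX eqxx.
Qed.

Lemma row_space_code_neighbour_transitive :
  neighbour_transitive (@W3_adj q) (W3_code code).
Proof.
pose e : 'rV['F_q]_2 := delta_mx 0 0.
have e0 : e != 0.
  by apply/eqP=> /rowP/(_ 0)/eqP; rewrite !mxE /= oner_eq0.
have ee0 : pair_row e e != 0 by rewrite pair_row_eq0 negb_and e0.
have v1 : is_point (graph_line (GLval (1%g : {'GL_2['F_q]})))
       || is_line (graph_line (GLval (1%g : {'GL_2['F_q]}))).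
  by rewrite graph_line_isotropic ?orbT // det_G.
have vee : is_point <[pair_row e e]>%VS || is_line <[pair_row e e]>%VS.
  by rewrite is_point_line.
(* The base vertices are the line [[I | I]] and the point [<(e, e)>] on it. *)
apply: (@neighbour_transitiveP _ _ _ (W3_vertex_of v1)
                                     (W3_vertex_of vee)).
- by rewrite inE graph_line_code.
- by apply/code_neighboursP; exists e, e.
- move=> x; rewrite inE => /row_space_codeP[X XG xE].
  (* The isometry [diag(1, X)] takes [[I | I]] to [[I | X]]. *)
  have [f [s sA [sE _ fL]]] := code_aut_diag (group1 G) XG.
  exists s => //; apply: val_inj.
  by rewrite sE [LHS]fL xE invg1 !mul1g.
- move=> y /code_neighboursP[a [b [a0 b0 yE]]].
  have [X XG eX] := sharp_exists e0 a0; have [Y YG eY] := sharp_exists e0 b0.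
  have [f [s sA [sE fE _]]] := code_aut_diag XG YG.
  exists s => //; apply: val_inj.
  by rewrite sE [LHS]limg_line fE eX eY yE.
Qed.

End Code.

End SymplecticForm.

Theorem lemma5p5 (q : nat) (hq : q \in [:: 2; 3; 5; 7; 11])
    (G : {group {'GL_2['F_q]}}) (hSL : (G \subset 'SL_2(q))%g)
    (hsharp : sharply_transitive_nonzero G)
    (hG : [/\ q = 2 -> (G \isog 'GL_1[GF4])%g,
              q = 3 -> (G \isog 'Q_8)%g,
              q = 5 -> double_cover_in_SL2 5 G 'Alt_('I_4)%G,
              q = 7 -> double_cover_in_SL2 7 G 'Sym_('I_4)%G
            & q = 11 -> (G \isog 'SL_2(5))%g]) :
  maximal_partial_spread (row_space_code G)
  /\ neighbour_transitive (@W3_adj q) (W3_code (row_space_code G)).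
Proof.
split; first exact: row_space_code_maximal.
exact: row_space_code_neighbour_transitive.
Qed.
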